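(* Let $G$ be a finite group and $S\subset G$ a normal subset. Put $\Gamma=X(G,S)$, $\Gamma^+=X^+(G,S)$, $\Gamma_e=MX(G;S,\{e\})$ and $\Gamma_e^+=MX^+(G;S,\{e\})$. If $Spec(\Gamma)\subset\mathbb{R}$ and neither $\Gamma$ nor $\Gamma^+$ has an eigenvalue in $(-1,1)$ other than possibly $0$, then $\{\Gamma_e,\Gamma_e^+\}$ are equienergetic non-isospectral graphs if and only if $\{\Gamma,\Gamma^+\}$ are equienergetic non-isospectral graphs.
   Context: A subset $S$ of $G$ is normal if $gSg^{-1}=S$ for every $g\in G$. $X(G,S)$ is the Cayley graph with vertex set $G$ and a directed edge from $h$ to $g$ iff $gh^{-1}\in S$; $X^+(G,S)$ is the Cayley sum graph with vertex set $G$ and a directed edge from $h$ to $g$ iff $gh\in S$ (loops allowed). If $A$ (resp. $A^+$) is the adjacency matrix of $\Gamma$ (resp. $\Gamma^+$), then $\Gamma_e=\Gamma\Box P_2$ (resp. $\Gamma_e^+=\Gamma^+\Box P_2$), the Cartesian product with the 2-path, is the graph with vertex set $G\times\mathbb{Z}_2$ and adjacency matrix $\begin{pmatrix}A&I\\ I&A\end{pmatrix}$ (resp. $\begin{pmatrix}A^+&I\\ I&A^+\end{pmatrix}$). $Spec$ is the multiset of complex eigenvalues of the adjacency matrix counted with (algebraic) multiplicity, and the energy is $\mathcal{E}(\Gamma)=\sum_{\lambda\in Spec(\Gamma)}|\lambda|$. Two graphs with the same number of vertices are equienergetic if they have the same energy and isospectral if they have the same spectrum (as multisets). *)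

(* Defs.v *)
From HB Require Import structures.
From mathcomp Require Import all_boot all_order all_algebra all_fingroup.
From mathcomp Require Import reals.
From mathcomp.real_closed Require Import complex.

Set Implicit Arguments.
Unset Strict Implicit.
Unset Printing Implicit Defensive.

Import Order.TTheory GRing.Theory Num.Theory.

(* A (directed, loops allowed) graph on a finite vertex type T is a relation  *)
(* e : rel T; e x y means that there is an edge from x to y.                  *)

Section CayleyGraphs.
Local Open Scope group_scope.
Variable gT : finGroupType.
Implicit Types (S : {set gT}) (g h : gT).

(* S :^ x is x^-1 S x, so S :^ g^-1 is g S g^-1. *)
Definition normal_subset S : Prop := forall g, S :^ g^-1 = S.

Definition cayley S : rel gT := fun h g => g * h^-1 \in S.

Definition cayley_sum S : rel gT := fun h g => g * h \in S.

End CayleyGraphs.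

Definition cartesian_product (T U : finType) (e : rel T) (f : rel U) :
    rel (T * U) :=
  fun x y => (e x.1 y.1 && (x.2 == y.2)) || ((x.1 == y.1) && f x.2 y.2).

Definition path2 : rel 'Z_2 := fun i j => i != j.

(* With connection set {e} between the two layers, MX(G;S,{e}) is X(G,S) box  *)
(* P_2 and MX^+(G;S,{e}) is X^+(G,S) box P_2.                                 *)
Definition mcayley_e (gT : finGroupType) (S : {set gT}) :
  rel (gT * 'Z_2) := cartesian_product (cayley S) path2.

Definition mcayley_sum_e (gT : finGroupType) (S : {set gT}) :
  rel (gT * 'Z_2) := cartesian_product (cayley_sum S) path2.

Section Spectrum.
Local Open Scope ring_scope.
Variable C : numClosedFieldType.

Definition adjacency (T : finType) (e : rel T) : 'M[C]_#|T| :=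
  \matrix_(i, j) (e (enum_val i) (enum_val j))%:R.

(* The roots of the characteristic polynomial, listed with multiplicity; the  *)
(* order of the list is irrelevant, spectra are compared with perm_eq.        *)
Definition spectrum (T : finType) (e : rel T) : seq C :=
  sval (closed_field_poly_normal (char_poly (adjacency e))).

Definition energy (T : finType) (e : rel T) : C :=
  \sum_(l <- spectrum e) `|l|.

Definition equienergetic (T U : finType) (e : rel T) (f : rel U) : Prop :=
  #|T| = #|U| /\ energy e = energy f.

Definition isospectral (T U : finType) (e : rel T) (f : rel U) : Prop :=
  #|T| = #|U| /\ perm_eq (spectrum e) (spectrum f).

Lemma char_poly_spectrum (T : finType) (e : rel T) :
  char_poly (adjacency e) = \prod_(l <- spectrum e) ('X - l%:P).
Proof.
rewrite /spectrum; case: closed_field_poly_normal => r /= {1}->.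
by rewrite (monicP (char_poly_monic _)) scale1r.
Qed.

(* Up to the enumeration of T * 'Z_2, the adjacency matrix of e box P_2 is    *)
(* the block matrix with blocks A, I, I, A.                                   *)
Lemma adjacency_path2 (T : finType) (e : rel T) (x y : T * 'Z_2) :
  adjacency (cartesian_product e path2) (enum_rank x) (enum_rank y) =
    if x.2 == y.2 then adjacency e (enum_rank x.1) (enum_rank y.1)
    else (1%:M : 'M_#|T|) (enum_rank x.1) (enum_rank y.1).
Proof.
rewrite !mxE !enum_rankK /cartesian_product /path2 (inj_eq enum_rank_inj).
by case: eqP => _ /=; rewrite ?andbT ?andbF ?orbF.
Qed.

End Spectrum.

(* Main.v *)
Require Import Defs.
From HB Require Import structures.
From mathcomp Require Import all_boot all_order all_algebra all_fingroup.
From mathcomp Require Import reals.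
From mathcomp.real_closed Require Import complex.

(** Write A and A+ for the adjacency matrices of the Cayley graph and of the
    Cayley sum graph. Normality of S makes A a normal matrix and A+ a symmetric
    one, and the substitution k |-> k^-1 in the group shows that the two Gram
    matrices A^T A and (A+)^T A+ = (A+)^2 are equal. A normal matrix is
    unitarily diagonalizable, so the eigenvalues of its Gram matrix are the
    |l|^2 for l an eigenvalue: the multisets of absolute values of eigenvalues
    of A and A+ coincide [perm_abs_spectrum]. In particular the two graphs
    always have the same energy [cayley_equienergetic].

    The Cartesian product of any graph with the 2-path has as eigenvalues the
    l - 1 and the l + 1, for l an eigenvalue of the graph [spectrum_path2]. For
    a real l, |l - 1| + |l + 1| only depends on |l|, so when the eigenvalues
    are real (which is automatic for the symmetric A+) the products have the
    same energy as well [cayley_path2_equienergetic].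

    Hence both sides of the equivalence reduce to their non-isospectrality
    part, and these parts agree because a finite multiset of scalars s can be
    recovered from the multiset union of s - 1 and s + 1 [perm_shift_cancel]:
    the multiplicities satisfy m_s(x) + m_s(x + 2) = m_t(x) + m_t(x + 2), and
    both vanish at x + 2k for some k. *)

Set Implicit Arguments.
Unset Strict Implicit.
Unset Printing Implicit Defensive.

Import Order.TTheory GRing.Theory Num.Theory.
Local Open Scope ring_scope.
Local Open Scope complex_scope.

(** * Characteristic polynomials *)

Lemma char_poly_simmx (F : fieldType) n (P A B : 'M[F]_n) :
  P \in unitmx -> P *m A = B *m P -> char_poly A = char_poly B.
Proof.
rewrite unitmxE unitfE => detP PA; rewrite /char_poly.
have : map_mx polyC P *m char_poly_mx A = char_poly_mx B *m map_mx polyC P.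
  by rewrite /char_poly_mx mulmxBr mulmxBl -!map_mxM PA scalar_mxC.
move/(congr1 determinant); rewrite !det_mulmx mulrC => /mulIf; apply.
by rewrite det_map_mx polyC_eq0.
Qed.

(** This frees spectra from the enumeration of the vertices: the sizes m and n
    are equal but need not be convertible, so f is not a permutation. *)
Lemma char_poly_mxsub (F : fieldType) m n (f : 'I_m -> 'I_n) (A : 'M[F]_n) :
  bijective f -> char_poly (mxsub f f A) = char_poly A.
Proof.
move=> bij_f; have eq_mn : m = n.
  by have := bij_eq_card bij_f; rewrite !card_ord.
subst m; pose s := perm (bij_inj bij_f).
symmetry; apply: (@char_poly_simmx _ _ (perm_mx s)); first exact: unitmx_perm.
rewrite -row_permE -[s in RHS]invgK -col_permE.
by apply/matrixP => i j; rewrite !mxE -!(permE (bij_inj bij_f)) permKV.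
Qed.

Lemma char_poly_add_scalar (F : fieldType) n (A : 'M[F]_n) c :
  char_poly (A + c%:M) = char_poly A \Po ('X - c%:P).
Proof.
rewrite /char_poly -[RHS]/(comp_poly ('X - c%:P) _) -det_map_mx.
congr determinant; apply/matrixP => i j; rewrite !mxE /=.
rewrite comp_polyB comp_polyC raddfMn /= comp_polyX.
by rewrite polyCD polyCMn mulrnBl opprD addrA addrAC.
Qed.

(** Subtracting the second block row from the first, then adding the first
    block column to the second, is a similarity onto a block triangular
    matrix. *)
Lemma char_poly_block_path2 (F : fieldType) n (A : 'M[F]_n) :
  char_poly (block_mx A 1%:M 1%:M A) =
  char_poly (A - 1%:M) * char_poly (A + 1%:M).
Proof.
pose P := block_mx 1%:M (- 1%:M) 0 1%:M : 'M[F]_(n + n).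
rewrite (@char_poly_simmx _ _ P _ (block_mx (A - 1%:M) 0 1%:M (A + 1%:M))).
- rewrite /char_poly /char_poly_mx map_block_mx scalar_mx_block.
  by rewrite opp_block_mx add_block_mx map_mx0 subr0 det_lblock.
- by rewrite unitmxE det_ublock !det1 mulr1 unitr1.
rewrite !mulmx_block !mul1mx !mulmx1 !mul0mx !mulNmx !mul1mx !mulmxN !mulmx1.
by rewrite mulmx0 !add0r !addr0 opprB [- _ + (_ + _)]addrC addrK.
Qed.

(** * Spectrum of the product with the 2-path *)

Section Path2.
Variable C : numClosedFieldType.

Lemma perm_spectrum (T : finType) (e : rel T) (s : seq C) :
  char_poly (adjacency C e) = \prod_(l <- s) ('X - l%:P) ->
  perm_eq (spectrum C e) s.
Proof. by rewrite char_poly_spectrum => /prod_XsubC_eq. Qed.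

Lemma prod_XsubC_shift (s : seq C) c :
  (\prod_(l <- s) ('X - l%:P)) \Po ('X - c%:P) =
  \prod_(l <- [seq l + c | l <- s]) ('X - l%:P).
Proof.
rewrite rmorph_prod big_map /=.
apply: eq_bigr => l _; rewrite comp_polyB comp_polyX comp_polyC.
by rewrite polyCD opprD addrA addrAC.
Qed.

Lemma spectrum_path2 (T : finType) (e : rel T) :
  perm_eq (spectrum C (cartesian_product e path2))
    ([seq l - 1 | l <- spectrum C e] ++ [seq l + 1 | l <- spectrum C e]).
Proof.
apply: perm_spectrum; rewrite big_cat /= -!prod_XsubC_shift.
rewrite -char_poly_spectrum -!char_poly_add_scalar raddfN /=.
pose n := #|T|.
(* List the vertices layer by layer, so that the adjacency matrix of the
   product becomes the block matrix with blocks A, 1, 1, A. *)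
pose f (i : 'I_(n + n)) : 'I_#|{: T * 'Z_2}| :=
  match split i with
  | inl j => enum_rank (enum_val j, 0 : 'Z_2)
  | inr j => enum_rank (enum_val j, 1 : 'Z_2)
  end.
have fl i : f (lshift n i) = enum_rank (enum_val i, 0).
  by rewrite /f (unsplitK (inl i)).
have fr i : f (rshift n i) = enum_rank (enum_val i, 1).
  by rewrite /f (unsplitK (inr i)).
have bij_f : bijective f.
  apply: inj_card_bij; last by rewrite !card_ord card_prod card_ord muln2 addnn.
  move=> i j; case: (split_ordP i) => a ->; case: (split_ordP j) => b ->;
    by rewrite ?fl ?fr => /enum_rank_inj[] // /enum_val_inj ->.
rewrite -char_poly_block_path2 -(char_poly_mxsub _ bij_f); congr char_poly.
apply/matrixP => i j; rewrite [LHS]mxE.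
case: (split_ordP i) => a ->; case: (split_ordP j) => b ->;
  by rewrite ?fl ?fr adjacency_path2 /= !enum_valK
             ?block_mxEul ?block_mxEur ?block_mxEdl ?block_mxEdr.
Qed.

(** Comparing multiplicities at x + 1 relates those at x and at x + 2, so
    agreement at x + 2k descends to x; in characteristic 0 the x + 2k are
    distinct, so one of them lies outside the finite sequences s and t. *)
Lemma perm_shift_cancel (s t : seq C) :
  perm_eq ([seq l - 1 | l <- s] ++ [seq l + 1 | l <- s])
          ([seq l - 1 | l <- t] ++ [seq l + 1 | l <- t]) ->
  perm_eq s t.
Proof.
move=> /seq.permP st.
have count_shift (r : seq C) c x :
    count_mem x [seq l + c | l <- r] = count_mem (x - c) r.
  by rewrite count_map; apply: eq_count => l; rewrite /= eq_sym -subr_eq eq_sym.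
have step x : count_mem (x + 2%:R) s = count_mem (x + 2%:R) t ->
    count_mem x s = count_mem x t.
  move=> eq_next; have := st (pred1 (x + 1)); rewrite !count_cat !count_shift.
  by rewrite opprK addrK -addrA eq_next => /addnI.
have far k x : count_mem (x + 2%:R *+ k) s = count_mem (x + 2%:R *+ k) t ->
    count_mem x s = count_mem x t.
  elim: k x => [|k IHk] x; first by rewrite addr0.
  by rewrite mulrS addrA => /IHk /step.
apply/allP => x _ /=; apply/eqP.
pose r := s ++ t; pose u := [seq x + 2%:R *+ k | k <- iota 0 (size r).+1].
have uniq_u : uniq u.
  rewrite map_inj_uniq ?iota_uniq // => i j /addrI /eqP.
  by rewrite -!mulrnA eqr_nat eqn_pmul2l // => /eqP.
have /allPn[y /mapP[k _ ->]] : ~~ all (mem r) u.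
  apply/negP => /allP /(uniq_leq_size uniq_u).
  by rewrite size_map size_iota ltnn.
rewrite inE mem_cat negb_or => /andP[ks kt]; apply: (far k).
by rewrite !(count_memPn _).
Qed.

Lemma isospectral_path2 (T U : finType) (e : rel T) (f : rel U) :
  isospectral C (cartesian_product e path2) (cartesian_product f path2) <->
  isospectral C e f.
Proof.
have cardE : (#|{: T * 'Z_2}| = #|{: U * 'Z_2}|) <-> (#|T| = #|U|).
  rewrite !card_prod card_ord; split=> [/eqP|-> //].
  by rewrite eqn_pmul2r // => /eqP.
split=> -[/cardE TU ef]; split=> //.
  apply: perm_shift_cancel.
  by rewrite -(permPl (spectrum_path2 e)) -(permPr (spectrum_path2 f)).
rewrite (permPl (spectrum_path2 e)) (permPr (spectrum_path2 f)).
by apply: perm_cat; apply: perm_map.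
Qed.

Lemma energyE (T : finType) (e : rel T) :
  energy C e = \sum_(l <- [seq `|l| | l <- spectrum C e]) l.
Proof. by rewrite big_map. Qed.

(** The point of summing over the absolute values is that graphs with real
    eigenvalues of the same absolute values then have products of the same
    energy: replacing l by - l exchanges the two terms. *)
Lemma energy_path2 (T : finType) (e : rel T) :
  {in spectrum C e, forall l, l \is Num.real} ->
  energy C (cartesian_product e path2) =
  \sum_(l <- [seq `|l| | l <- spectrum C e]) (`|l - 1| + `|l + 1|).
Proof.
move=> real_e.
rewrite /energy (perm_big _ (spectrum_path2 e)) big_cat /= !big_map.
rewrite -big_split /= big_seq [RHS]big_seq; apply: eq_bigr => l /real_e.
rewrite realE => /orP[/ger0_norm -> // | /ler0_norm ->].
by rewrite -opprD normrN [LHS]addrC [- l + 1]addrC distrC.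
Qed.

End Path2.

(** * Absolute values of the eigenvalues of normal matrices *)

Section NormalMatrices.
Local Open Scope sesquilinear_scope.
Variable C : numClosedFieldType.

Lemma char_poly_diag n (v : 'rV[C]_n) :
  char_poly (diag_mx v) =
  \prod_(l <- [seq v 0 i | i <- enum 'I_n]) ('X - l%:P).
Proof.
rewrite char_poly_trig ?diag_mx_is_trig // big_map big_enum /=.
by apply: eq_bigr => i _; rewrite mxE eqxx.
Qed.

Lemma char_poly_normalmx n (A : 'M[C]_n) :
  A \is normalmx -> char_poly A = char_poly (diag_mx (spectral_diag A)).
Proof.
move=> /orthomx_spectralP defA; have Pu := spectral_unit A.
by apply: (char_poly_simmx Pu); rewrite {2}defA !mulmxA mulmxV // mul1mx.
Qed.

(** If A = P^-1 D P with P unitary, then A^* A = P^-1 (D^* D) P. *)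
Lemma char_poly_normalmx_gram n (A : 'M[C]_n) (s : seq C) :
  A \is normalmx -> char_poly A = \prod_(l <- s) ('X - l%:P) ->
  char_poly (A ^t* *m A) = \prod_(l <- [seq `|l| ^+ 2 | l <- s]) ('X - l%:P).
Proof.
move=> A_normal; have /orthomx_spectralP := A_normal.
rewrite char_poly_normalmx // char_poly_diag.
have Pu := spectral_unit A; have PU := spectral_unitarymx A.
move: (spectralmx A) (spectral_diag A) Pu PU => P d Pu PU defA.
move=> /prod_XsubC_eq ds.
rewrite -(perm_big _ (perm_map _ ds)) -map_comp /=.
rewrite (@char_poly_simmx _ _ P _ (diag_mx (\row_i (`|d 0 i| ^+ 2)))) //.
  rewrite char_poly_diag; congr (\big[_/_]_(_ <- _) _).
  by apply: eq_map => i; rewrite mxE.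
rewrite defA invmx_unitary // !trmx_mul !map_mxM !mulmxA trmxCK.
rewrite (unitarymxP PU) mul1mx mulmxtVK //; congr (_ *m _).
rewrite tr_diag_mx map_diag_mx mulmx_diag; congr diag_mx.
by apply/rowP => i; rewrite !mxE normCK mulrC.
Qed.

Lemma adjacency_conj (T : finType) (e : rel T) :
  adjacency C e ^t* = (adjacency C e)^T.
Proof. by apply/matrixP => i j; rewrite !mxE rmorph_nat. Qed.

Lemma adjacency_hermsym (T : finType) (e : rel T) :
  symmetric e -> adjacency C e \is hermsymmx.
Proof.
move=> sym_e; apply/is_hermitianmxP; rewrite expr0 scale1r adjacency_conj.
by apply/matrixP => i j; rewrite !mxE sym_e.
Qed.

Lemma spectrum_real (T : finType) (e : rel T) :
  symmetric e -> {in spectrum C e, forall l, l \is Num.real}.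
Proof.
move=> /adjacency_hermsym herm_e l.
have := char_poly_normalmx (hermitian_normalmx herm_e).
rewrite char_poly_spectrum char_poly_diag => /prod_XsubC_eq /perm_mem ->.
by case/mapP=> i _ ->; apply/mxOverP/hermitian_spectral_diag_real.
Qed.

Lemma perm_abs_spectrum (T U : finType) (e : rel T) (f : rel U) :
  adjacency C e \is normalmx -> adjacency C f \is normalmx ->
  char_poly (adjacency C e ^t* *m adjacency C e) =
  char_poly (adjacency C f ^t* *m adjacency C f) ->
  perm_eq [seq `|l| | l <- spectrum C e] [seq `|l| | l <- spectrum C f].
Proof.
move=> normal_e normal_f.
rewrite (char_poly_normalmx_gram normal_e (char_poly_spectrum C e)).
rewrite (char_poly_normalmx_gram normal_f (char_poly_spectrum C f)).
move=> /prod_XsubC_eq /(perm_map sqrtC).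
have sqrtE (s : seq C) :
    [seq sqrtC l | l <- [seq `|l| ^+ 2 | l <- s]] = [seq `|l| | l <- s].
  by rewrite -map_comp; apply: eq_map => l /=; rewrite sqrCK ?normr_ge0.
by rewrite !sqrtE.
Qed.

End NormalMatrices.

(** * Cayley graphs and Cayley sum graphs *)

Section Cayley.
Variables (C : numClosedFieldType) (gT : finGroupType) (S : {set gT}).

Lemma normal_subset_mulgC (S_normal : normal_subset S) g h :
  (g * h \in S)%g = (h * g \in S)%g.
Proof. by rewrite -{1}(S_normal g) mem_conjgV conjgE -mulgA mulKg. Qed.

Lemma cayley_sum_sym (S_normal : normal_subset S) : symmetric (cayley_sum S).
Proof. by move=> h g; apply: normal_subset_mulgC. Qed.

Lemma gram_adjacencyE (e : rel gT) i j :
  ((adjacency C e)^T *m adjacency C e) i j =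
  \sum_(k : gT) (e k (enum_val i) && e k (enum_val j))%:R.
Proof.
rewrite mxE (reindex (@enum_rank gT)) /=; last first.
  by apply: onW_bij; apply: enum_rank_bij.
by apply: eq_bigr => k _; rewrite !mxE enum_rankK -natrM mulnb.
Qed.

(** The common out-neighbours of h and g are put in bijection with their common
    in-neighbours by k |-> h k^-1 g, up to conjugacy of the quotients. *)
Lemma adjacency_cayley_normal (S_normal : normal_subset S) :
  adjacency C (cayley S) \is normalmx.
Proof.
apply/normalmxP; rewrite adjacency_conj.
pose e' : rel gT := fun h g => cayley S g h.
have eT : (adjacency C (cayley S))^T = adjacency C e'.
  by apply/matrixP => i j; rewrite !mxE.
(* Seen on the reversed graph e', A A^T is a Gram matrix too. *)
rewrite -{1}[adjacency C (cayley S)]trmxK {1 2}eT.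
apply/matrixP => i j; rewrite !gram_adjacencyE.
set h := enum_val i; set g := enum_val j.
rewrite (reindex (fun k => h * k^-1 * g)%g) /=; last first.
  apply: onW_bij; exists (fun k => g * k^-1 * h)%g => k;
    by rewrite !(invMg, invgK, mulgA) ?mulgV ?mul1g ?mulgKV ?mulgK ?mulgV
               ?mul1g.
apply: eq_bigr => k _; rewrite /e' /cayley andbC; congr (_ && _)%:R.
  by rewrite mulgK.
by rewrite normal_subset_mulgC // -!mulgA mulKg normal_subset_mulgC.
Qed.

(** A+ is A with its rows permuted by inversion, and permuting rows does not
    change a Gram matrix. *)
Lemma gram_cayley_sum :
  (adjacency C (cayley_sum S))^T *m adjacency C (cayley_sum S) =
  (adjacency C (cayley S))^T *m adjacency C (cayley S).
Proof.
apply/matrixP => i j; rewrite !gram_adjacencyE (reindex_inj invg_inj) /=.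
by apply: eq_bigr => k _; rewrite /cayley_sum.
Qed.

Lemma perm_abs_spectrum_cayley (S_normal : normal_subset S) :
  perm_eq [seq `|l| | l <- spectrum C (cayley S)]
          [seq `|l| | l <- spectrum C (cayley_sum S)].
Proof.
apply: perm_abs_spectrum; first exact: adjacency_cayley_normal.
  exact/hermitian_normalmx/adjacency_hermsym/cayley_sum_sym.
by rewrite !adjacency_conj gram_cayley_sum.
Qed.

Lemma cayley_equienergetic (S_normal : normal_subset S) :
  equienergetic C (cayley S) (cayley_sum S).
Proof.
by split=> //; rewrite !energyE; apply/perm_big/perm_abs_spectrum_cayley.
Qed.

Lemma cayley_path2_equienergetic (S_normal : normal_subset S) :
  {in spectrum C (cayley S), forall l, l \is Num.real} ->
  equienergetic C (mcayley_e S) (mcayley_sum_e S).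
Proof.
move=> real_S; split=> //.
rewrite (energy_path2 real_S) (energy_path2 (spectrum_real _)).
  exact/perm_big/perm_abs_spectrum_cayley.
exact: cayley_sum_sym.
Qed.

End Cayley.

Theorem proposition6p7 (R : realType) (gT : finGroupType) (S : {set gT})
    (S_normal : normal_subset S)
    (spec_real : forall l : R[i],
       l \in spectrum R[i] (cayley S) -> l \is Num.real)
    (spec_gap : forall l : R[i],
       l \in spectrum R[i] (cayley S) -> -1 < l < 1 -> l = 0)
    (spec_sum_gap : forall l : R[i],
       l \in spectrum R[i] (cayley_sum S) -> -1 < l < 1 -> l = 0) :
  (equienergetic R[i] (mcayley_e S) (mcayley_sum_e S) /\
   ~ isospectral R[i] (mcayley_e S) (mcayley_sum_e S)) <->
  (equienergetic R[i] (cayley S) (cayley_sum S) /\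
   ~ isospectral R[i] (cayley S) (cayley_sum S)).
Proof.
have energy_eq := cayley_equienergetic R[i] S_normal.
have energy_e_eq := cayley_path2_equienergetic S_normal spec_real.
by split=> -[_ not_iso]; split=> // /isospectral_path2.
Qed.
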